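(* Let $n$ be a positive integer. For a divisor $d$ of $n$, let $\Psi_{n,d}(X):=\frac{X^{n}-1}{\Phi_{d}(X)}=(1+X^{d}+X^{2d}+\dots+X^{n-d})\,\Psi_d(X)\in\mathbb{Z}[X]$, where $\Phi_d(X)$ is the $d$-th cyclotomic polynomial and $\Psi_d(X)=\frac{X^d-1}{\Phi_d(X)}$ is the $d$-th inverse cyclotomic polynomial. Then for any pair of distinct divisors $d_{1}\neq d_{2}$ of $n$, and any integers $l_1,l_2$ with $0 \leq l_{1} \leq \varphi(d_{1})-1$ and $0 \leq l_{2} \leq \varphi(d_{2})-1$ (where $\varphi$ is Euler's totient function), one has \[ \langle X^{l_{1}} \Psi_{n,d_{1}}(X),\, X^{l_{2}} \Psi_{n,d_{2}}(X)\rangle =0.\]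
   Context: The bilinear form $\langle\cdot,\cdot\rangle$ on $\mathbb{Q}[X]$ is defined by $\langle \sum_{k\ge 0} a_{k}X^{k},\sum_{k\ge 0} b_{k}X^{k}\rangle=\sum_{k\ge 0} a_{k}b_{k}$, i.e. the sum of products of corresponding coefficients. *)

(* Defs.v *)
From HB Require Import structures.
From mathcomp Require Import all_boot all_order all_algebra all_field.

Set Implicit Arguments.
Unset Strict Implicit.
Unset Printing Implicit Defensive.

Import Order.TTheory GRing.Theory Num.Theory.
Local Open Scope ring_scope.

(* All terms of the sum over k >= 0 vanish beyond the stated bound; see
   coef_formE for independence of the bound. *)
Definition coef_form (p q : {poly rat}) : rat :=
  \sum_(k < maxn (size p) (size q)) p`_k * q`_k.

Lemma coef_formE (N : nat) (p q : {poly rat}) :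
  (maxn (size p) (size q) <= N)%N -> coef_form p q = \sum_(k < N) p`_k * q`_k.
Proof.
move=> leN; rewrite /coef_form (big_ord_widen N (fun k => p`_k * q`_k) leN).
rewrite big_mkcond; apply: eq_bigr => k _; case: ltnP => // lek.
by rewrite nth_default ?mul0r // (leq_trans (leq_maxl _ _) lek).
Qed.

(* 'Phi_d is monic, so the pseudo-division %/ over int is a genuine Euclidean
   division; it is exact when d divides n > 0 (Psi_mul_Cyclotomic). *)
Definition Psi (n d : nat) : {poly int} := ('X^n - 1) %/ 'Phi_d.

Definition inverse_Cyclotomic (d : nat) : {poly int} := ('X^d - 1) %/ 'Phi_d.

Lemma mulCyclotomicK (d : nat) (p : {poly int}) : (p * 'Phi_d) %/ 'Phi_d = p.
Proof. by rewrite Pdiv.IdomainMonic.mulpK ?Cyclotomic_monic. Qed.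

Lemma Psi_mul_Cyclotomic (n d : nat) :
  (0 < n)%N -> (d %| n)%N -> Psi n d * 'Phi_d = 'X^n - 1.
Proof.
move=> n_gt0 d_dv_n; rewrite /Psi -prod_Cyclotomic //.
by rewrite (big_rem d) -?dvdn_divisors //= ['Phi_d * _]mulrC mulCyclotomicK.
Qed.

Lemma Psi_inverse_Cyclotomic (n d : nat) :
  (0 < n)%N -> (d %| n)%N ->
  Psi n d = (\sum_(i < n %/ d) 'X^(i * d)) * inverse_Cyclotomic d.
Proof.
move=> n_gt0 d_dv_n; have d_gt0 := dvdn_gt0 n_gt0 d_dv_n.
rewrite -[RHS](mulCyclotomicK d) -mulrA.
rewrite -/(Psi d d) Psi_mul_Cyclotomic // /Psi; congr (_ %/ _).
rewrite -{1}(divnK d_dv_n) mulnC exprM subrX1 mulrC; congr (_ * _).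
by apply: eq_bigr => i _; rewrite -exprM mulnC.
Qed.

(* Main.v *)
(** Parseval's identity for the discrete Fourier transform of length [n] turns
    the coefficient form of two polynomials of degree less than [n] into a sum of
    [p(w) q(w^-1)] over the [n]-th roots of unity [w]. Since [Psi n d] vanishes
    at all of these except the primitive [d]-th ones, and [w] and [w^-1] have the
    same order, every term is zero when [d1 <> d2]. *)

Require Import Defs.
From mathcomp Require Import all_boot all_order all_algebra all_field.

Set Implicit Arguments.
Unset Strict Implicit.
Unset Printing Implicit Defensive.

Import Order.TTheory GRing.Theory Num.Theory.
Local Open Scope ring_scope.

Lemma sum_expr_unity_root (F : fieldType) (n : nat) (w : F) :
  w ^+ n = 1 -> \sum_(j < n) w ^+ j = n%:R *+ (w == 1).
Proof.
move=> wn1; case: eqP => [->|/eqP w_neq1].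
  by under eq_bigr do rewrite expr1n; rewrite sumr_const card_ord.
apply/eqP; move/eqP: (subrX1 w n).
by rewrite wn1 subrr eq_sym mulf_eq0 subr_eq0 (negPf w_neq1).
Qed.

(** Expanding both evaluations and summing over [j] first leaves geometric sums in
    [z ^+ k / z ^+ l], which vanish off the diagonal. Inverting the root takes the place of complex
    conjugation, so any field will do. *)
Lemma parseval_poly (F : fieldType) (n : nat) (z : F) (p q : {poly F}) :
  n.-primitive_root z -> (size p <= n)%N -> (size q <= n)%N ->
  n%:R * \sum_(k < n) p`_k * q`_k =
  \sum_(j < n) p.[z ^+ j] * q.[(z ^+ j)^-1].
Proof.
move=> prim_z size_p size_q.
have z_neq0 : z != 0.
  rewrite -unitfE -(unitrX_pos _ (prim_order_gt0 prim_z)).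
  by rewrite (prim_expr_order prim_z) unitr1.
transitivity (\sum_(j < n) \sum_(k < n) \sum_(l < n)
    p`_k * q`_l * (z ^+ k / z ^+ l) ^+ j); last first.
  apply: eq_bigr => j _.
  rewrite (horner_coef_wide _ size_p) (horner_coef_wide _ size_q) big_distrlr /=.
  apply: eq_bigr => k _; apply: eq_bigr => l _.
  by rewrite exprMn !exprVn -!exprM !(mulnC j) mulrACA.
rewrite exchange_big mulr_sumr; apply: eq_bigr => k _ /=.
rewrite exchange_big (bigD1 k) //= [X in _ = _ + X]big1 => [|l l_neq_k].
  rewrite addr0 -mulr_sumr divff ?expf_neq0 //.
  by rewrite sum_expr_unity_root ?expr1n // eqxx mulrC.
rewrite -mulr_sumr sum_expr_unity_root.
  (* The ratio is 1 only if [k] and [l] agree modulo [n], hence only if they are equal, both being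
     below [n]. *)
  rewrite (can2_eq (divfK _) (mulfK _)) ?expf_neq0 // mul1r.
  rewrite (eq_prim_root_expr prim_z) !modn_small //.
  by rewrite eq_sym (inj_eq val_inj) (negPf l_neq_k) mulr0.
rewrite exprMn exprVn -!exprM !(mulnC _ n) !exprM (prim_expr_order prim_z).
by rewrite !expr1n divr1.
Qed.

Lemma root_Cyclotomic (d : nat) (w : algC) :
  (0 < d)%N -> root (map_poly intr 'Phi_d) w = d.-primitive_root w.
Proof.
move=> d_gt0; have [z prim_z] := C_prim_root_exists d_gt0.
by rewrite (Cintr_Cyclotomic prim_z) root_cyclotomic.
Qed.

(** At [w] the product [Psi n d * 'Phi_d] takes the value [w ^+ n - 1 = 0], so one of the two
    factors vanishes there. *)
Lemma Psi_nonroot (n d : nat) (w : algC) :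
  (0 < n)%N -> (d %| n)%N -> w ^+ n = 1 ->
  (map_poly intr (Psi n d)).[w] != 0 -> d.-primitive_root w.
Proof.
move=> n_gt0 d_dv_n wn1 nz; rewrite -root_Cyclotomic ?(dvdn_gt0 n_gt0) //.
have /(congr1 (fun p => (map_poly intr p).[w])) := Psi_mul_Cyclotomic n_gt0 d_dv_n.
rewrite rmorphM rmorphB rmorph1 /= map_polyXn !hornerE wn1 subrr => /eqP.
by rewrite mulf_eq0 (negPf nz).
Qed.

(** [Psi n d] has degree [n - totient d], so the bound on [l] keeps the shifted degree below [n], as
    Parseval requires. *)
Lemma size_mulXn_Psi (n d l : nat) :
  (0 < n)%N -> (d %| n)%N -> (l <= totient d - 1)%N ->
  (size ('X^l * map_poly (intr : int -> rat) (Psi n d))%R <= n)%N.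
Proof.
move=> n_gt0 d_dv_n l_le; have d_gt0 := dvdn_gt0 n_gt0 d_dv_n.
have := congr1 (fun p : {poly int} => size p) (Psi_mul_Cyclotomic n_gt0 d_dv_n).
rewrite size_Mmonic ?Cyclotomic_monic //; last first.
  apply/eqP => Psi0; move/eqP: (Psi_mul_Cyclotomic n_gt0 d_dv_n).
  by rewrite Psi0 mul0r eq_sym (negPf (monic_neq0 (monicXnsubC 1 n_gt0))).
rewrite size_Cyclotomic size_XnsubC // addnS /= => size_eq.
rewrite (leq_trans (size_polyMleq _ _)) // size_polyXn addSn /=.
rewrite (leq_trans (leq_add l_le (size_poly _ _))) //.
have := totient_gt0 d; rewrite d_gt0 => tot_gt0.
by rewrite -ltnS -size_eq addnC -ltn_subRL addKn subn1 prednK.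
Qed.

Theorem theorem1 (n : nat) (n_gt0 : (0 < n)%N)
    (d1 d2 : nat) (d1_dvd : (d1 %| n)%N) (d2_dvd : (d2 %| n)%N)
    (d1_neq_d2 : d1 <> d2)
    (l1 l2 : nat) (l1_le : (l1 <= totient d1 - 1)%N)
    (l2_le : (l2 <= totient d2 - 1)%N) :
  coef_form ('X^l1 * map_poly (intr : int -> rat) (Psi n d1))
            ('X^l2 * map_poly (intr : int -> rat) (Psi n d2)) = 0.
Proof.
have size1 := size_mulXn_Psi n_gt0 d1_dvd l1_le.
have size2 := size_mulXn_Psi n_gt0 d2_dvd l2_le.
rewrite (coef_formE (N := n)) ?geq_max ?size1 //.
have [z prim_z] := C_prim_root_exists n_gt0.
have to_algC (l d : nat) :
  map_poly (ratr : rat -> algC) ('X^l * map_poly intr (Psi n d)) =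
  'X^l * map_poly intr (Psi n d).
  rewrite rmorphM /= map_polyXn -map_poly_comp.
  by congr (_ * _); apply: eq_map_poly => m /=; rewrite ratr_int.
(* The rational identity is checked in [algC], where the primitive root [z] lives. *)
apply: (fmorph_inj (ratr : {rmorphism rat -> algC})).
rewrite rmorph0 rmorph_sum /=.
under eq_bigr do rewrite rmorphM -!coef_map.
apply: (mulfI (_ : n%:R != 0)); first by rewrite pnatr_eq0 -lt0n.
rewrite mulr0 (parseval_poly prim_z) ?size_map_poly //.
apply: big1 => j _; rewrite !to_algC !hornerM; set w := z ^+ j.
have wn1 : w ^+ n = 1 by rewrite exprAC (prim_expr_order prim_z) expr1n.
have wVn1 : w^-1 ^+ n = 1 by rewrite exprVn wn1 invr1.
have [->|nz1] := eqVneq (map_poly intr (Psi n d1)).[w] 0.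
  by rewrite mulr0 mul0r.
have [->|nz2] := eqVneq (map_poly intr (Psi n d2)).[w^-1] 0.
  by rewrite !mulr0.
have prim1 := Psi_nonroot n_gt0 d1_dvd wn1 nz1.
have prim2 := Psi_nonroot n_gt0 d2_dvd wVn1 nz2.
(* Now [w] has order [d1] and [w^-1] has order [d2]; each order divides the other, since
   [w ^+ d2 = 1] and [w^-1 ^+ d1 = 1]. *)
case: d1_neq_d2; apply/eqP; rewrite eqn_dvd.
rewrite (prim_order_dvd prim1) (prim_order_dvd prim2).
rewrite -(inj_eq invr_inj) invr1 -exprVn (prim_expr_order prim2) eqxx /=.
by rewrite exprVn (prim_expr_order prim1) invr1.
Qed.
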